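(* Let $A_1\in\mathbb{R}^{p\times n}$ have full column rank, $A_2\in\mathbb{R}^{q\times n}$, assume that $A_1^TA_1-A_2^TA_2$ is symmetric positive definite, let $S\in\mathbb{R}^{n\times n}$ be symmetric positive definite, and let $\alpha>0$. Put $Y=S+A_1^TA_1$. Then all eigenvalues of the preconditioned matrix $\mathscr{P}_{\mathrm{RBRS}}^{-1}\mathcal{K}$ are real and belong to the interval $(0,1]$. More precisely, $\mathscr{P}_{\mathrm{RBRS}}^{-1}\mathcal{K}$ has $1$ as an eigenvalue with (algebraic) multiplicity at least $p$, and the remaining $n+q$ eigenvalues (counted with multiplicity) are the same as those of the symmetric matrix $$\widehat{H}=\begin{bmatrix} I_n-S^{1/2}Y^{-1}S^{1/2} & S^{1/2}Y^{-1}A_2^T \\ A_2Y^{-1}S^{1/2} & I_q-A_2Y^{-1}A_2^T \end{bmatrix},$$ which satisfy $0<\lambda_i(\widehat H)\le 1$. Hence $0<\lambda_i\bigl(\mathscr{P}_{\mathrm{RBRS}}^{-1}\mathcal{K}\bigr)\le 1$ for all $i$.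
   Context: The matrices are $$\mathcal{K}=\begin{bmatrix} I_p & A_1 & 0 \\ -A_1^T & 0 & A_2^T \\ 0 & A_2 & I_q \end{bmatrix},\qquad \mathscr{P}_{\mathrm{RBRS}}=\begin{bmatrix} I_p & A_1 & 0 \\ -A_1^T & S & 0 \\ 0 & A_2 & I_q \end{bmatrix}.$$ $S^{1/2}$ is the symmetric positive definite square root of $S$, and $\lambda_i(M)$ denotes the eigenvalues of $M$. The parameter $\alpha$ does not enter these matrices. The standing assumption is that $A^T\mathcal{J}A=A_1^TA_1-A_2^TA_2$ is symmetric positive definite, where $A=\begin{bmatrix} A_1 \\ A_2 \end{bmatrix}$ and $\mathcal{J}=\mathrm{diag}(I_p,-I_q)$. *)

(* Defs.v *)
From HB Require Import structures.
From mathcomp Require Import all_boot all_order all_algebra.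
From mathcomp Require Import boolp classical_sets reals.
From mathcomp Require Export complex.

Set Implicit Arguments.
Unset Strict Implicit.
Unset Printing Implicit Defensive.

Import Order.TTheory GRing.Theory Num.Theory.
Local Open Scope ring_scope.

Definition spd (R : realType) (n : nat) (M : 'M[R]_n) : Prop :=
  M^T = M /\ forall x : 'cV[R]_n, x != 0 -> 0 < (x^T *m M *m x) 0 0.

(* M^(1/2), chosen classically among the symmetric positive definite square
   roots of M; it defaults to 0 when M has none, hence is only meaningful for
   symmetric positive definite M, where the square root is unique. *)
Definition spd_sqrt (R : realType) (n : nat) (M : 'M[R]_n) : 'M[R]_n :=
  xget 0 (fun T : 'M[R]_n => spd T /\ T *m T = M).

Definition cplx_mx (R : realType) (m n : nat) (M : 'M[R]_(m, n)) : 'M[R[i]]_(m, n) :=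
  map_mx (real_complex R) M.

(* All complex eigenvalues of a real matrix, repeated according to algebraic
   multiplicity: the roots of its (monic) characteristic polynomial.  The order
   of the sequence carries no meaning, so compare such sequences with perm_eq. *)
Definition eigenvalues (R : realType) (n : nat) (M : 'M[R]_n) : seq R[i] :=
  sval (closed_field_poly_normal (char_poly (cplx_mx M))).

Section Matrices.
Variables (R : realType) (p n q : nat).
Variables (A1 : 'M[R]_(p, n)) (A2 : 'M[R]_(q, n)) (S : 'M[R]_n).

Definition calK : 'M[R]_(p + (n + q)) :=
  block_mx 1%:M              (row_mx A1 0)
           (col_mx (- A1^T) 0) (block_mx 0  A2^T
                                         A2 1%:M).

Definition P_RBRS : 'M[R]_(p + (n + q)) :=
  block_mx 1%:M              (row_mx A1 0)
           (col_mx (- A1^T) 0) (block_mx S  0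
                                         A2 1%:M).

Definition Ymx : 'M[R]_n := S + A1^T *m A1.

Definition Hhat : 'M[R]_(n + q) :=
  let Sh := spd_sqrt S in
  let Yi := invmx Ymx in
  block_mx (1%:M - Sh *m Yi *m Sh) (Sh *m Yi *m A2^T)
           (A2 *m Yi *m Sh)        (1%:M - A2 *m Yi *m A2^T).

End Matrices.

(* Main.v *)
Require Import Defs.
From mathcomp Require Import all_boot all_order all_algebra.
From mathcomp Require Import boolp classical_sets reals complex spectral.

Set Implicit Arguments.
Unset Strict Implicit.
Unset Printing Implicit Defensive.

Import Order.TTheory GRing.Theory Num.Theory.
Local Open Scope ring_scope.

(** The argument is one block elimination followed by one quadratic form.

    Write [P], [K] for the preconditioner and the matrix, [Y = S + A1^T A1].
    Eliminating the first block row of [P] leaves the Schur complement [Y], so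
    [\det P = \det Y] ([det_P_RBRS]); and since [K] and [P] differ only in their
    middle block row, [P^-1 K] is block upper triangular with diagonal blocks
    [I_p] and [N] ([precond_block], [reduced_mx]).  The block [I_p] accounts for
    the eigenvalue 1 with multiplicity [p].  Conjugating [N] by
    [diag(S^(1/2), I)] gives the symmetric matrix [H]
    ([charpoly_reduced_Hhat]), whence an equality of characteristic polynomials
    that contains all the multiplicities.

    For the bounds, put [B = [S^(1/2); - A2]].  Then [H = I - B Y^-1 B^T]
    ([Hhat_gram]) and [Y - B^T B = A1^T A1 - A2^T A2] is positive definite.
    If [Y w = B^T x], then completing the square gives
      [x^T H x = x^T x - w^T Y w = |x - B w|^2 + w^T (Y - B^T B) w]
    ([quad_Hhat], [quad_Hhat_sum]).  The first expression is at most [x^T x];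
    the second is positive when [x] is nonzero, since [w = 0] leaves [|x|^2].
    A real symmetric matrix has real eigenvalues with real eigenvectors
    ([sym_eigenvalue_real]), so those of [H] lie in (0, 1].

    The existence of [S^(1/2)] ([spd_sqrt_exists]) descends from the complex
    spectral theorem: the eigenvalues of [S] are positive reals, so a real
    polynomial [q] can interpolate the fourth root on them, and [Q = q(S)] is
    then a real symmetric matrix with [Q^4 = S].  The root is [Q^2 = Q^T Q],
    which is positive definite as a Gram matrix. *)

(** * Real symmetric and positive definite matrices *)

Lemma sqnorm_gt0 (R : realType) n (x : 'cV[R]_n) :
  x != 0 -> 0 < (x^T *m x) 0 0.
Proof.
move=> x0; rewrite mxE.
have ge0 i : true -> 0 <= x^T 0 i * x i 0 by rewrite mxE -expr2 sqr_ge0.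
rewrite lt0r sumr_ge0 // andbT; apply: contra x0 => /eqP s0.
apply/eqP/colP => i; rewrite [RHS]mxE.
have /(_ i isT) /eqP := psumr_eq0P ge0 s0.
by rewrite mxE -expr2 sqrf_eq0 => /eqP.
Qed.

Lemma sqnorm_ge0 (R : realType) k (x : 'cV[R]_k) : 0 <= (x^T *m x) 0 0.
Proof.
by have [->|/sqnorm_gt0/ltW//] := eqVneq x 0; rewrite mulmx0 mxE.
Qed.

Lemma quad_gram (R : realType) m k (B : 'M[R]_(m, k)) (x : 'cV[R]_k) :
  x^T *m (B^T *m B) *m x = (B *m x)^T *m (B *m x).
Proof. by rewrite trmx_mul !mulmxA. Qed.

Lemma mulmx_cplx_Re (R : realType) m n (v : 'M[R[i]]_(m, n)) p
    (H : 'M[R]_(n, p)) :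
  map_mx (@complex.Re R) (v *m cplx_mx H) = map_mx (@complex.Re R) v *m H.
Proof.
apply/matrixP=> i j; rewrite !mxE raddf_sum /=; apply: eq_bigr => k _.
by rewrite !mxE; case: (v i k) => a b /=; rewrite mulr0 subr0.
Qed.

Lemma mulmx_cplx_Im (R : realType) m n (v : 'M[R[i]]_(m, n)) p
    (H : 'M[R]_(n, p)) :
  map_mx (@complex.Im R) (v *m cplx_mx H) = map_mx (@complex.Im R) v *m H.
Proof.
apply/matrixP=> i j; rewrite !mxE raddf_sum /=; apply: eq_bigr => k _.
by rewrite !mxE; case: (v i k) => a b /=; rewrite mulr0 add0r mulrC.
Qed.

(** If [a + i b] is an eigenvector for [r + i s], then comparing [(a H) b^T]
    with [(b H) a^T], which symmetry makes equal, yields [s (|a|^2 + |b|^2) = 0].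
    So [s = 0], and [a] and [b] are real eigenvectors unless they vanish. *)
Lemma sym_eigenvalue_real (R : realType) n (H : 'M[R]_n) (z : R[i]) :
    H^T = H -> eigenvalue (cplx_mx H) z ->
  exists r : R, exists2 x : 'cV[R]_n, z = real_complex R r &
    x != 0 /\ H *m x = r *: x.
Proof.
move=> symH /eigenvalueP[v vH v0].
pose a := map_mx (@complex.Re R) v; pose b := map_mx (@complex.Im R) v.
case: z vH => r s vH.
have aH : a *m H = r *: a - s *: b.
  rewrite -mulmx_cplx_Re vH; apply/matrixP=> i j; rewrite !mxE.
  by case: (v i j).
have bH : b *m H = r *: b + s *: a.
  rewrite -mulmx_cplx_Im vH; apply/matrixP=> i j; rewrite !mxE.
  by case: (v i j) => c d /=.
have ab0 : (a != 0) || (b != 0).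
  rewrite -negb_and; apply: contra v0 => /andP[/eqP a0 /eqP b0].
  apply/eqP/matrixP=> i j; rewrite mxE.
  have := congr1 (fun M : 'M__ => M i j) a0.
  have := congr1 (fun M : 'M__ => M i j) b0.
  by rewrite !mxE; case: (v i j) => c d /= -> ->.
have sqT (c : 'rV[R]_n) : c != 0 -> 0 < (c *m c^T) 0 0.
  by move=> c0; rewrite -{1}[c]trmxK sqnorm_gt0 // trmx_eq0.
have sq0 (c : 'rV[R]_n) : 0 <= (c *m c^T) 0 0.
  by rewrite -{1}[c]trmxK sqnorm_ge0.
have s0 : s = 0.
  have E : a *m H *m b^T = (b *m H *m a^T)^T.
    by rewrite !trmx_mul symH trmxK mulmxA.
  have /eqP : s * ((a *m a^T) 0 0 + (b *m b^T) 0 0) = 0.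
    have abC : (b *m a^T) 0 0 = (a *m b^T) 0 0.
      by rewrite -[b *m a^T]trmxK trmx_mul trmxK mxE.
    move: E; rewrite aH bH !mulmxDl !mulNmx -!scalemxAl => /matrixP/(_ 0 0).
    move: (a *m a^T) (b *m b^T) (a *m b^T) (b *m a^T) abC => aa bb ab ba abC.
    rewrite !mxE abC => /addrI E'.
    by rewrite mulrDr -E' addNr.
  rewrite mulf_eq0 => /orP[/eqP//|].
  rewrite gt_eqF //; case/orP: ab0 => /sqT c0.
    by rewrite ltr_wpDr.
  by rewrite ltr_wpDl.
move: aH bH; rewrite s0 !scale0r subr0 addr0 => aH bH.
have tr (c : 'rV[R]_n) : c *m H = r *: c -> H *m c^T = r *: c^T.
  by move=> cH; rewrite -[H *m _]trmxK trmx_mul trmxK symH cH linearZ.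
by exists r; case/orP: ab0 => c0; [exists a^T | exists b^T] => //;
  rewrite trmx_eq0; split => //; apply: tr.
Qed.

Lemma spd_eigenvalue_gt0 (R : realType) n (H : 'M[R]_n) (z : R[i]) :
    spd H -> eigenvalue (cplx_mx H) z ->
  exists2 r : R, z = real_complex R r & 0 < r.
Proof.
move=> [symH posH] /(sym_eigenvalue_real symH)[r [x -> [x0 Hx]]].
exists r => //; have := posH x x0.
by rewrite -mulmxA Hx -scalemxAr mxE pmulr_lgt0 // sqnorm_gt0.
Qed.

Lemma spd_eigenvalue_le1 (R : realType) n (H : 'M[R]_n) (z : R[i]) :
    spd H -> (forall x : 'cV[R]_n, (x^T *m H *m x) 0 0 <= (x^T *m x) 0 0) ->
    eigenvalue (cplx_mx H) z ->
  exists2 r : R, z = real_complex R r & 0 < r <= 1.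
Proof.
move=> spdH leH zH.
have [r zr r0] := spd_eigenvalue_gt0 spdH zH.
have [r' [x zr' [x0 Hx]]] := sym_eigenvalue_real (proj1 spdH) zH.
exists r => //; rewrite r0 /=.
have -> : r = r' by apply: (@complexI R); rewrite -zr zr'.
rewrite -(ler_pM2r (sqnorm_gt0 x0)) mul1r.
by have := leH x; rewrite -mulmxA Hx -scalemxAr mxE.
Qed.

Lemma spd_unitmx (R : realType) n (M : 'M[R]_n) : spd M -> M \in unitmx.
Proof.
move=> [_ posM]; rewrite unitmxE unitfE; apply/negP => /det0P[v v0 vM].
by have := posM v^T; rewrite trmx_eq0 v0 trmxK vM mul0mx mxE ltxx => /(_ isT).
Qed.

Lemma spd_gram (R : realType) n (Q : 'M[R]_n) :
  Q \in unitmx -> spd (Q^T *m Q).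
Proof.
move=> uQ; split=> [|x x0]; first by rewrite trmx_mul trmxK.
rewrite quad_gram; apply: sqnorm_gt0; apply: contra x0 => /eqP Qx.
by rewrite -[x](mulKmx uQ) Qx mulmx0.
Qed.

(** * The positive definite square root *)

Lemma poly_interp (F : fieldType) (s : seq F) (f : F -> F) :
  exists q : {poly F}, {in s, forall x, q.[x] = f x}.
Proof.
elim: s => [|x s [q qf]]; first by exists 0.
have [xs|xs] := boolP (x \in s).
  by exists q => y; rewrite inE => /predU1P[->|]; apply: qf.
pose w := \prod_(y <- s) ('X - y%:P).
have w0 : w.[x] != 0 by rewrite -/(root w x) root_prod_XsubC.
exists (q + ((f x - q.[x]) / w.[x])%:P * w) => y.
rewrite inE !hornerE => /predU1P[->|ys]; first by rewrite divfK // addrC subrK.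
suff -> : w.[y] = 0 by rewrite mulr0 addr0 qf.
by apply/eqP; rewrite -/(root w y) root_prod_XsubC.
Qed.

Lemma trmx_horner_mx (R : comNzRingType) n (A : 'M[R]_n.+1) (p : {poly R}) :
  (horner_mx A p)^T = horner_mx A^T p.
Proof.
elim/poly_ind: p => [|p c IH]; first by rewrite !rmorph0 trmx0.
rewrite !rmorphD !rmorphM /= !horner_mx_C !horner_mx_X linearD /= tr_scalar_mx.
rewrite trmx_mul IH; congr (_ + _).
by rewrite -[LHS](comm_horner_mx p (erefl (A^T *m A^T))).
Qed.

(** The root must be real, whereas the spectral decomposition is complex.
    Polynomials in [S] with real coefficients are real and symmetric, and the
    complex diagonalization serves only to check an identity between them.
    Interpolating the fourth root rather than the square root makes the
    resulting [Q^2] a Gram matrix, hence positive definite. *)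
Lemma spd_sqrt_exists (R : realType) n (S : 'M[R]_n) :
  spd S -> exists T : 'M[R]_n, spd T /\ T *m T = S.
Proof.
case: n S => [|n] S spdS.
  by exists S; split=> //; apply/matrixP => -[].
pose toC := real_complex R.
have symS : cplx_mx S \is normalmx.
  apply/hermitian_normalmx/realsym_hermsym.
    rewrite qualifE /= expr0 scale1r map_mx_id // /cplx_mx map_trmx.
    by rewrite (proj1 spdS).
  apply/mxOverP => i j; rewrite mxE; apply/complex_realP; by eexists.
have := orthomx_spectralP symS.
set P := spectralmx _; set d := spectral_diag _ => Sd.
have uP : P \in unitmx by apply: spectral_unit.
have dP i : {r : R | d 0 i = toC r & 0 < r}.
  apply: cid2; apply: spd_eigenvalue_gt0 spdS _.
  apply/eigenvalueP; exists (row i P).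
    rewrite -row_mul {1}Sd !mulmxA mulmxV // mul1mx.
    by apply/rowP => j; rewrite mul_diag_mx !mxE.
  apply/eqP => Pi; have /rowP/(_ i)/eqP := congr1 (mulmx^~ (invmx P)) Pi.
  by rewrite /= -row_mul mulmxV // mul0mx !mxE eqxx oner_eq0.
pose r i := s2val (dP i).
have [q qr] := poly_interp [seq r i | i : 'I_n.+1]
  (fun x => Num.sqrt (Num.sqrt x)).
pose Q := horner_mx S q.
have symQ : Q^T = Q by rewrite trmx_horner_mx (proj1 spdS).
have Q4 : Q *m Q *m (Q *m Q) = S.
  have -> : Q *m Q *m (Q *m Q) = horner_mx S (q * q * (q * q)).
    by rewrite !rmorphM.
  apply: (@map_mx_inj _ _ toC); rewrite map_horner_mx -/(cplx_mx S).
  rewrite [in LHS]Sd horner_mx_uconjC // [RHS]Sd; congr (_ *m _ *m _).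
  rewrite horner_mx_diag; congr diag_mx; apply/rowP => i; rewrite mxE.
  rewrite /d (s2valP (dP i)) -/(r i) horner_map; congr toC.
  have r0 : 0 <= r i by apply/ltW/(s2valP' (dP i)).
  rewrite !hornerM qr; last by apply: map_f; rewrite mem_enum.
  by rewrite -!expr2 !sqr_sqrtr ?sqrtr_ge0.
exists (Q *m Q); split=> //; rewrite -{1}symQ; apply: spd_gram.
have := spd_unitmx spdS; rewrite -{1}Q4.
by rewrite !unitmx_mul => /andP[/andP[]].
Qed.

Lemma spd_sqrtP (R : realType) n (S : 'M[R]_n) : spd S ->
  spd (spd_sqrt S) /\ spd_sqrt S *m spd_sqrt S = S.
Proof. by move=> /spd_sqrt_exists; apply: xgetPex. Qed.

(** * Characteristic polynomials *)

Lemma char_poly_block1 (R : comNzRingType) m n (X : 'M[R]_(m, n)) (N : 'M[R]_n) :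
  char_poly (block_mx 1%:M X 0 N) = ('X - 1%:P) ^+ m * char_poly N.
Proof.
rewrite /char_poly /char_poly_mx map_block_mx map_mx0.
rewrite scalar_mx_block opp_block_mx add_block_mx oppr0 addr0 det_ublock.
by rewrite map_scalar_mx -raddfB det_scalar.
Qed.

Lemma char_poly_simmx (F : fieldType) n (D A B : 'M[F]_n) :
  D \in unitmx -> D *m A = B *m D -> char_poly A = char_poly B.
Proof.
move=> uD DA; pose Dp := map_mx polyC D.
have dD : \det Dp != 0.
  by rewrite det_map_mx polyC_eq0 -unitfE -unitmxE.
apply: (mulfI dD); rewrite [RHS]mulrC -!det_mulmx.
rewrite mulmxBr mulmxBl -!map_mxM DA; congr (\det (_ - _)).
by rewrite scalar_mxC.
Qed.

Lemma eigenvalues_prod (R : realType) n (M : 'M[R]_n) :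
  \prod_(z <- eigenvalues M) ('X - z%:P) = char_poly (cplx_mx M).
Proof.
rewrite /eigenvalues; case: closed_field_poly_normal => s /= ->.
by rewrite (monicP (char_poly_monic _)) scale1r.
Qed.

(** * Block elimination *)

Section Blocks.
Variables (R : realType) (p n q : nat).
Variables (A1 : 'M[R]_(p, n)) (A2 : 'M[R]_(q, n)) (S : 'M[R]_n).

(** The Schur complement of the identity block in the upper left corner of
    [P_RBRS] is block lower triangular, with diagonal blocks [Y] and [I_q]. *)
Lemma det_P_RBRS : \det (P_RBRS A1 A2 S) = \det (Ymx A1 S).
Proof.
have -> : P_RBRS A1 A2 S =
    block_mx 1%:M 0 (col_mx (- A1^T) 0) 1%:M *m
    block_mx 1%:M (row_mx A1 0) 0 (block_mx (Ymx A1 S) 0 A2 1%:M).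
  rewrite mulmx_block !mul1mx !mulmx1 !mul0mx !addr0 mul_col_row.
  rewrite !mul0mx mulmx0 add_block_mx !add0r /Ymx mulNmx.
  by rewrite addrCA addNr addr0.
by rewrite det_mulmx det_lblock det_ublock det_lblock !det1 !(mul1r, mulr1).
Qed.

(** The lower right block of the preconditioned matrix. *)
Definition reduced_mx : 'M[R]_(n + q) :=
  let Yi := invmx (Ymx A1 S) in
  block_mx (1%:M - Yi *m S) (Yi *m A2^T)
           (A2 *m Yi *m S)  (1%:M - A2 *m Yi *m A2^T).

Lemma precond_block : Ymx A1 S \in unitmx ->
  invmx (P_RBRS A1 A2 S) *m calK A1 A2 =
  block_mx 1%:M (row_mx (A1 *m invmx (Ymx A1 S) *m S)
                        (- (A1 *m invmx (Ymx A1 S) *m A2^T)))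
           0 reduced_mx.
Proof.
move=> uY; have uP : P_RBRS A1 A2 S \in unitmx.
  by rewrite unitmxE det_P_RBRS -unitmxE.
apply: (canLR (mulKmx uP)).
rewrite /reduced_mx /P_RBRS /calK; set W := invmx _.
(* This is [Y W = 1], solved for the occurrence of [A1^T A1] in [Y]. *)
have YW k (C : 'M[R]_(n, k)) : A1^T *m (A1 *m (W *m C)) = C - S *m (W *m C).
  apply/eqP; rewrite -subr_eq opprK addrC !mulmxA -!mulmxDl.
  by rewrite mulmxV // mul1mx.
rewrite mulmx_block !mul1mx !mulmx1 !mulmx0 !addr0 mul_row_block mul_col_row.
rewrite mulmx_block add_row_mx add_block_mx !mul0mx !addr0 !add0r.
rewrite !mulmxBr !mulmx1 !mulNmx !mulmxN opprK -!mulmxA !YW.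
by rewrite !mul1mx ![_ *m _ + (_ - _)]addrC !subrK !addNr.
Qed.

(** The similarity is by [diag(S^(1/2), I)]. *)
Lemma charpoly_reduced_Hhat : spd S ->
  char_poly reduced_mx = char_poly (Hhat A1 A2 S).
Proof.
move=> spdS; have [spdT TT] := spd_sqrtP spdS.
pose D : 'M_(n + q) := block_mx (spd_sqrt S) 0 0 1%:M.
have uD : D \in unitmx.
  by rewrite unitmxE det_ublock det1 mulr1 -unitmxE spd_unitmx.
apply: (char_poly_simmx uD); rewrite /D /reduced_mx /Hhat !mulmx_block.
rewrite !mul0mx !mulmx0 !mul1mx !mulmx1 !addr0 !add0r.
rewrite mulmxBr mulmxBl mulmx1 mul1mx -{2 4}TT.
by rewrite -!mulmxA TT.
Qed.

(** * The quadratic form of the symmetrized matrix *)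

(** The matrix [B] for which [B^T B = S + A2^T A2], in the factorization of [Hhat]
    as [I - B Y^-1 B^T]. *)
Definition sqrt_stack : 'M[R]_(n + q, n) := col_mx (spd_sqrt S) (- A2).

Lemma Hhat_gram : spd S -> Hhat A1 A2 S =
  1%:M - sqrt_stack *m invmx (Ymx A1 S) *m sqrt_stack^T.
Proof.
move=> spdS; have [[symT _] _] := spd_sqrtP spdS.
rewrite /sqrt_stack tr_col_mx linearN /= symT mul_col_mx mul_col_row.
rewrite scalar_mx_block opp_block_mx add_block_mx !mulNmx !mulmxN !opprK.
by rewrite !add0r.
Qed.

Hypothesis hA : spd (A1^T *m A1 - A2^T *m A2).
Hypothesis hS : spd S.

Lemma spd_Ymx : spd (Ymx A1 S).
Proof.
split=> [|x x0]; first by rewrite linearD /= trmx_mul trmxK (proj1 hS).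
rewrite mulmxDr mulmxDl quad_gram mxE.
by rewrite ltr_wpDr ?sqnorm_ge0 // (proj2 hS).
Qed.

Lemma Ymx_solve (x : 'cV[R]_(n + q)) :
  exists w : 'cV[R]_n, Ymx A1 S *m w = sqrt_stack^T *m x.
Proof.
by exists (invmx (Ymx A1 S) *m (sqrt_stack^T *m x));
  rewrite mulKVmx //; apply: spd_unitmx spd_Ymx.
Qed.

Lemma quad_Hhat (x : 'cV[R]_(n + q)) (w : 'cV[R]_n) :
    Ymx A1 S *m w = sqrt_stack^T *m x ->
  x^T *m Hhat A1 A2 S *m x = x^T *m x - w^T *m Ymx A1 S *m w.
Proof.
have uY := spd_unitmx spd_Ymx; have [symY _] := spd_Ymx => Yw.
have xB : x^T *m sqrt_stack = w^T *m Ymx A1 S.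
  by rewrite -[LHS]trmxK trmx_mul trmxK -Yw trmx_mul symY.
rewrite Hhat_gram // mulmxBr mulmxBl mulmx1 !mulmxA xB.
by rewrite -[_ *m _^T *m x]mulmxA -Yw mulmxK // mulmxA.
Qed.

(** Completing the square in [quad_Hhat], with
    [Y - B^T B = A1^T A1 - A2^T A2] for [B = sqrt_stack]. *)
Lemma quad_Hhat_sum (x : 'cV[R]_(n + q)) (w : 'cV[R]_n) :
    Ymx A1 S *m w = sqrt_stack^T *m x ->
  x^T *m Hhat A1 A2 S *m x =
  (x - sqrt_stack *m w)^T *m (x - sqrt_stack *m w) +
  w^T *m (A1^T *m A1 - A2^T *m A2) *m w.
Proof.
move=> Yw; have [symY _] := spd_Ymx; have [[symT _] TT] := spd_sqrtP hS.
have BB : A1^T *m A1 - A2^T *m A2 = Ymx A1 S - sqrt_stack^T *m sqrt_stack.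
  rewrite /sqrt_stack tr_col_mx mul_row_col symT TT [(- A2)^T]linearN /=.
  by rewrite mulNmx mulmxN opprK /Ymx opprD addrACA subrr add0r.
have xB : x^T *m sqrt_stack = w^T *m Ymx A1 S.
  by rewrite -[LHS]trmxK trmx_mul trmxK -Yw trmx_mul symY.
rewrite (quad_Hhat Yw) BB [(x - _)^T]linearB /= trmx_mul.
rewrite !(mulmxBl, mulmxBr) !mulmxA xB -[_ *m _ *m x]mulmxA -Yw !mulmxA.
by rewrite subrK.
Qed.

(** Both terms of [quad_Hhat_sum] are nonnegative.  If [w] is nonzero the second
    one is positive, and if [w = 0] the first one is [x^T x]. *)
Lemma spd_Hhat : spd (Hhat A1 A2 S).
Proof.
have [symY _] := spd_Ymx.
split=> [|x x0].
  by rewrite Hhat_gram // linearB /= trmx1 !trmx_mul trmxK trmx_inv symY mulmxA.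
have [w Yw] := Ymx_solve x.
rewrite (quad_Hhat_sum Yw) mxE.
have [->|w0] := eqVneq w 0.
  by rewrite !mulmx0 subr0 [X in _ < _ + X]mxE addr0 sqnorm_gt0.
by rewrite ltr_wpDl ?sqnorm_ge0 // (proj2 hA).
Qed.

Lemma Hhat_le1 (x : 'cV[R]_(n + q)) :
  (x^T *m Hhat A1 A2 S *m x) 0 0 <= (x^T *m x) 0 0.
Proof.
have [w Yw] := Ymx_solve x.
rewrite (quad_Hhat Yw) [leLHS]mxE gerDl [leLHS]mxE oppr_le0.
have [->|/(proj2 spd_Ymx)/ltW//] := eqVneq w 0.
by rewrite mulmx0 mxE.
Qed.

End Blocks.

(** * The eigenvalues of the preconditioned matrix *)

Unset Implicit Arguments.

Theorem theorem4 (R : realType) (p n q : nat)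
    (A1 : 'M[R]_(p, n)) (A2 : 'M[R]_(q, n)) (S : 'M[R]_n) (alpha : R)
    (hA1 : \rank A1 = n)
    (hA : spd (A1^T *m A1 - A2^T *m A2))
    (hS : spd S)
    (halpha : 0 < alpha) :
  let M := invmx (P_RBRS A1 A2 S) *m calK A1 A2 in
  let H := Hhat A1 A2 S in
  (* the inverses and the square root occurring in M and H exist *)
  [/\ P_RBRS A1 A2 S \in unitmx, Ymx A1 S \in unitmx,
      spd (spd_sqrt S) & spd_sqrt S *m spd_sqrt S = S]
  /\
  (* all complex eigenvalues of M are real and lie in (0, 1] *)
  (forall z : R[i], eigenvalue (cplx_mx M) z ->
     exists2 r : R, z = real_complex R r & 0 < r <= 1)
  /\
  (* 1 has algebraic multiplicity at least p; the others are those of H *)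
  (p <= mup 1 (char_poly M))%N
  /\ size (eigenvalues H) = (n + q)%N
  /\ perm_eq (eigenvalues M) (nseq p 1 ++ eigenvalues H)
  /\
  (* H is symmetric with eigenvalues in (0, 1] *)
  H^T = H
  /\ (forall z : R[i], eigenvalue (cplx_mx H) z ->
        exists2 r : R, z = real_complex R r & 0 < r <= 1).
Proof.
move=> M H.
have uY := spd_unitmx (spd_Ymx A1 hS); have [spdT TT] := spd_sqrtP hS.
have uP : P_RBRS A1 A2 S \in unitmx by rewrite unitmxE det_P_RBRS -unitmxE.
have spdH : spd H := spd_Hhat hA hS.
have cM : char_poly M = ('X - 1%:P) ^+ p * char_poly H.
  by rewrite /M precond_block // char_poly_block1 charpoly_reduced_Hhat.
have cMC : char_poly (cplx_mx M) = ('X - 1%:P) ^+ p * char_poly (cplx_mx H).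
  rewrite -!map_char_poly cM rmorphM rmorphXn rmorphB /= map_polyX.
  by rewrite map_polyC rmorph1.
have eigH z : eigenvalue (cplx_mx H) z ->
    exists2 r : R, z = real_complex R r & 0 < r <= 1.
  exact: spd_eigenvalue_le1 spdH (Hhat_le1 A1 A2 hS).
split; first by split.
split=> [z|].
  rewrite eigenvalue_root_char cMC rootM => /orP[|].
    rewrite /root horner_exp expf_eq0 hornerXsubC subr_eq0 => /andP[_ /eqP ->].
    by exists 1; rewrite ?rmorph1 // ltr01 lexx.
  by rewrite -eigenvalue_root_char; apply: eigH.
split.
  rewrite mup_geq ?monic_neq0 ?char_poly_monic // cM.
  exact: dvdp_mulIl.
split.
  by apply: succn_inj; rewrite -(size_prod_XsubC _ id) eigenvalues_prod size_char_poly.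
split; last by split=> //; apply: (proj1 spdH).
apply: prod_XsubC_eq; rewrite big_cat /= !eigenvalues_prod cMC.
by rewrite big_nseq iter_mulr_1.
Qed.
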